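(* Let $S_1,S_2:[0,1]^2\to[0,1]$ be continuous cancellative t-subnorms with additive generators $s_1:[0,1]\to[s_1(1),\infty]$ and $s_2:[0,1]\to[s_2(1),\infty]$, respectively (normalized, i.e. $s_i(1)=1$, whenever $S_i$ is proper). If the function $s_1\circ s_2^{-1}:[s_2(1),\infty]\to[s_1(1),\infty]$ is convex, then the following are equivalent: (i) $S_1\le S_2$ (pointwise on $[0,1]^2$); (ii) the function $x\mapsto \frac{s_1\circ s_2^{-1}(x)}{x}$ is non-increasing on $(s_2(1),\infty)$.
   Context: A t-subnorm is a binary operation $S:[0,1]^2\to[0,1]$ that is commutative, associative, non-decreasing in both variables and satisfies $S(x,y)\le\min(x,y)$. It is cancellative if $S(x,y)=S(x,z)$ with $x>0$ implies $y=z$. A t-norm is a t-subnorm having $1$ as neutral element; a t-subnorm that is not a t-norm is called proper. By a known representation theorem, a t-subnorm $S$ is continuous and cancellative if and only if there is a continuous, strictly decreasing function $s:[0,1]\to[0,\infty]$ with $s(0)=\infty$ such that $S(x,y)=s^{-1}(s(x)+s(y))$ for all $x,y\in[0,1]$, where $s$ is viewed as a bijection $[0,1]\to[s(1),\infty]$ with inverse $s^{-1}$. Such an $s$ is called an additive generator of $S$; it is unique up to a positive multiplicative constant; $S$ is a (strict) t-norm iff $s(1)=0$ and proper iff $s(1)>0$. When $S$ is proper, its normalized additive generator is the one with $s(1)=1$. Convexity of $h:[a,\infty]\to[0,\infty]$ (with $h(\infty)=\infty$, $h$ finite elsewhere) means $h(\lambda x+(1-\lambda)y)\le\lambda h(x)+(1-\lambda)h(y)$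 for all $x,y\in[a,\infty)$ and $\lambda\in[0,1]$. *)

(* Defs.v *)
From HB Require Import structures.
From mathcomp Require Import all_boot all_order all_algebra.
From mathcomp Require Import all_classical all_reals all_analysis.

Set Implicit Arguments.
Unset Strict Implicit.
Unset Printing Implicit Defensive.

Import Order.TTheory GRing.Theory Num.Theory.
Import numFieldNormedType.Exports.

Local Open Scope classical_set_scope.
Local Open Scope ring_scope.

(* Functions on [0,1] are represented by total functions on R; every
   definition below only looks at their values on [0,1]. *)
Definition I01 {R : realType} : set R := `[0, 1].

Record tsubnorm {R : realType} (S : R -> R -> R) : Prop := Tsubnorm {
  tsubnorm_in : forall x y, I01 x -> I01 y -> I01 (S x y) ;
  tsubnormC : forall x y, I01 x -> I01 y -> S x y = S y x ;
  tsubnormA : forall x y z, I01 x -> I01 y -> I01 z ->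
    S x (S y z) = S (S x y) z ;
  tsubnorm_homo : forall x x' y y', I01 x -> I01 x' -> I01 y -> I01 y' ->
    x <= x' -> y <= y' -> S x y <= S x' y' ;
  tsubnorm_le_min : forall x y, I01 x -> I01 y -> S x y <= Num.min x y
}.

Definition cancellative {R : realType} (S : R -> R -> R) : Prop :=
  forall x y z, I01 x -> I01 y -> I01 z -> 0 < x -> S x y = S x z -> y = z.

Definition continuous_on_square {R : realType} (S : R -> R -> R) : Prop :=
  {within I01 `*` I01, continuous (fun p : R * R => S p.1 p.2)}.

Definition tnorm {R : realType} (S : R -> R -> R) : Prop :=
  tsubnorm S /\ (forall x, I01 x -> S x 1 = x /\ S 1 x = x).

Definition proper_tsubnorm {R : realType} (S : R -> R -> R) : Prop :=
  tsubnorm S /\ ~ tnorm S.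

(* s^-1 : [s(1), +oo] -> [0,1]; the value 0 outside s([0,1]) is a dummy. *)
Definition gen_inv {R : realType} (s : R -> \bar R) : \bar R -> R :=
  'pinv_(fun=> 0) I01 s.

Record additive_generator {R : realType} (S : R -> R -> R) (s : R -> \bar R)
    : Prop := AdditiveGenerator {
  generator_ge0 : forall x, I01 x -> (0 <= s x)%E ;
  generator_continuous : {within I01, continuous s} ;
  generator_decr : forall x y, I01 x -> I01 y -> x < y -> (s y < s x)%E ;
  generator0 : s 0 = +oo%E ;
  generatorE : forall x y, I01 x -> I01 y -> S x y = gen_inv s (s x + s y)%E
}.

Definition convex_from {R : realType} (a : \bar R) (h : \bar R -> \bar R)
    : Prop :=
  forall x y t : R, (a <= x%:E)%E -> (a <= y%:E)%E -> I01 t ->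
    (h (t * x + (1 - t) * y)%:E <= t%:E * h x%:E + (1 - t)%:E * h y%:E)%E.

(* Main.v *)
(** Write [h] for [s1 \o gen_inv s2].  Applying the decreasing map [s1] to
    [S1 x y <= S2 x y] with [u = s2 x], [v = s2 y] turns (i) into the
    subadditivity of [h] on [[s2 1, oo)].  For a convex [h], subadditivity
    forces [h x / x] to be non-increasing: if [h y / y > h x / x] with [x < y],
    the secant of [h] through [x] and [y] has slope larger than [h y / y], so
    [h (2 y) > 2 h y].  Conversely, monotonicity of [h x / x] gives
    [u * h (u + v) <= (u + v) * h u], and the same with [v]; add the two.  The
    endpoint [u = s2 1], at which (ii) says nothing, is reached by convexity. *)
Require Import Defs.
From mathcomp Require Import all_boot all_order all_algebra.
From mathcomp Require Import all_classical all_reals all_analysis.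
From mathcomp Require Import ring lra.
Import Order.TTheory GRing.Theory Num.Theory.
Import numFieldNormedType.Exports.
Local Open Scope ring_scope.

Lemma convex_subadditiveP {R : realFieldType} (b : R) (h : R -> R) :
  0 <= b ->
  (forall x y t, b <= x -> b <= y -> 0 <= t <= 1 ->
     h (t * x + (1 - t) * y) <= t * h x + (1 - t) * h y) ->
  (forall u v, b <= u -> b <= v -> h (u + v) <= h u + h v)
  <-> (forall x y, b < x -> x <= y -> h y / y <= h x / x).
Proof.
move=> b0 hconv; split=> [hsub x y bx xy|hratio u v bu bv].
  have x0 : 0 < x by lra.
  have y0 : 0 < y by lra.
  move: xy; rewrite le_eqVlt => /predU1P[->//|xy].
  rewrite ler_pdivrMr// mulrAC ler_pdivlMr//.
  have xy2 : 0 < 2 * y - x by lra.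
  (* This weight makes [y] the convex combination of [2 * y] and [x]. *)
  pose t := (y - x) / (2 * y - x).
  have t01 : 0 <= t <= 1.
    by rewrite divr_ge0 ?ler_pdivrMr ?mul1r; lra.
  have by2 : b <= y + y by lra.
  have := hconv _ _ t by2 (ltW bx) t01.
  have -> : t * (y + y) + (1 - t) * x = y by rewrite /t; field; lra.
  have by1 : b <= y by lra.
  have := hsub _ _ by1 by1.
  case/andP: t01 => t0 t1 hs hc.
  have hts := ler_wpM2l t0 hs.
  (* Convexity at [y], with [h (y + y)] bounded by [2 * h y]. Scaling by [2 * y - x] clears the
     denominators of [t]. *)
  have H : h y * (1 - 2 * t) <= (1 - t) * h x by lra.
  have := ler_wpM2r (ltW xy2) H.
  have -> : h y * (1 - 2 * t) * (2 * y - x) = h y * x by rewrite /t; field; lra.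
  have -> // : (1 - t) * h x * (2 * y - x) = h x * y by rewrite /t; field; lra.
(* Monotonicity of the ratio without denominators, extended to [w = b]. *)
have key w z : b <= w -> w <= z -> b < z -> w * h z <= z * h w.
  rewrite le_eqVlt => /predU1P[<- bz bz'|bw wz _]; last first.
    have := hratio _ _ bw wz.
    rewrite ler_pdivrMr; last lra.
    by rewrite mulrAC ler_pdivlMr; lra.
  (* The midpoint [m] of [b] and [z] lies above [b], so [m * h z <= z * h m]. Bounding [h m] by the
     mean of [h b] and [h z] cancels the term [z * h z / 2] and leaves [b * h z <= z * h b]. *)
  have hb := hconv b z (1/2) (lexx _) bz ltac:(lra).
  have := hratio (1 / 2 * b + (1 - 1 / 2) * z) z ltac:(lra) ltac:(lra).
  rewrite ler_pdivrMr; last lra.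
  rewrite mulrAC ler_pdivlMr; last lra.
  have z0 : 0 <= z by lra.
  have := ler_wpM2r z0 hb.
  lra.
have [bu' | ub] := ltP b (u + v).
  have := key u (u + v) bu ltac:(lra) bu'.
  have := key v (u + v) bv ltac:(lra) bu'.
  move=> hv hu.
  suff : (u + v) * h (u + v) <= (u + v) * (h u + h v) by rewrite ler_pM2l; lra.
  lra.
(* Here [u + v <= b] with [u] and [v] at least [b >= 0] forces all three to vanish. It remains to
   see [0 <= h 0], which is [key] at [0] and [1]. *)
have -> : u = 0 by lra.
have -> : v = 0 by lra.
have := key 0 1 ltac:(lra) ltac:(lra) ltac:(lra).
by rewrite addr0; lra.
Qed.

(** Balls of [\bar R] are preimages of real balls under [contract]. This brings the real
    intermediate value theorem to bear on generators, whose values may be infinite. *)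
Lemma contract_continuous {R : realType} : continuous (@contract R : \bar R -> R).
Proof.
move=> x; apply/cvg_ballP => e e0.
exact: (nbhsx_ballx x _ e0).
Qed.

Section generator.
Set Implicit Arguments.
Unset Strict Implicit.
Unset Printing Implicit Defensive.
Local Open Scope classical_set_scope.
Local Open Scope ring_scope.
Context {R : realType} {S : R -> R -> R} {s : R -> \bar R}
  (gS : additive_generator S s).

Let I0 : I01 (0 : R). Proof. by rewrite /I01 /= in_itv/= lexx ler01. Qed.
Let I1 : I01 (1 : R). Proof. by rewrite /I01 /= in_itv/= lexx ler01. Qed.

Lemma generator_le x y : I01 x -> I01 y -> (s y <= s x)%E = (x <= y).
Proof.
move=> Ix Iy; have [xy|yx|->] := ltgtP x y; last exact: lexx.
- exact/ltW/(generator_decr gS).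
- by apply/negbTE; rewrite -ltNge (generator_decr gS).
Qed.

Lemma generator_inj : {in I01 &, injective s}.
Proof.
move=> x y /set_mem Ix /set_mem Iy sxy.
by apply/le_anti; rewrite -!generator_le// sxy lexx.
Qed.

Lemma generator_surj v : (s 1 <= v)%E -> exists2 x, I01 x & s x = v.
Proof.
move=> s1v.
have cs : {within `[0 : R, 1], continuous (@contract R \o s)}.
  apply: within_continuous_comp; last exact: generator_continuous gS.
  by move=> x _; exact: contract_continuous.
have [|x x01 /contract_inj] := IVT (v := contract v) ler01 cs; last by exists x.
by rewrite ge_min le_max /= !le_contract s1v (generator0 gS) leey/= orbT.
Qed.

Lemma generator_fin_num x : I01 x -> 0 < x -> s x \is a fin_num.
Proof.
move=> Ix x0; rewrite ge0_fin_numE ?(generator_ge0 gS)//.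
by rewrite -(generator0 gS) (generator_decr gS).
Qed.

Lemma gen_inv_I01 v : (s 1 <= v)%E -> I01 (gen_inv s v).
Proof.
move=> /generator_surj[x Ix <-].
by rewrite /gen_inv pinvKV ?inE//; exact: generator_inj.
Qed.

Lemma generatorK x : I01 x -> gen_inv s (s x) = x.
Proof. by move=> Ix; rewrite /gen_inv pinvKV ?inE//; exact: generator_inj. Qed.

Lemma gen_invK v : (s 1 <= v)%E -> s (gen_inv s v) = v.
Proof. by move=> /generator_surj[x Ix <-]; rewrite generatorK. Qed.

Lemma gen_inv_gt0 (v : R) : (s 1 <= v%:E)%E -> 0 < gen_inv s v%:E.
Proof.
move=> sv; have := gen_inv_I01 sv; rewrite /I01/= in_itv/= => /andP[g0 _].
rewrite lt_neqAle g0 andbT; apply/eqP => g0E.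
by have := gen_invK sv; rewrite -g0E (generator0 gS).
Qed.

Lemma generator_ge1 x : I01 x -> (s 1 <= s x)%E.
Proof.
move=> Ix; rewrite generator_le//.
by move: Ix; rewrite /I01/= in_itv/= => /andP[].
Qed.

Lemma generatorD_ge1 x y : I01 x -> I01 y -> (s 1 <= s x + s y)%E.
Proof.
move=> Ix Iy; apply: (le_trans (generator_ge1 Ix)).
by rewrite leeDl// (generator_ge0 gS).
Qed.

Lemma generator_op x y : I01 x -> I01 y -> s (S x y) = (s x + s y)%E.
Proof. by move=> Ix Iy; rewrite (generatorE gS)// gen_invK// generatorD_ge1. Qed.

Lemma generator_op_I01 x y : I01 x -> I01 y -> I01 (S x y).
Proof.
by move=> Ix Iy; rewrite (generatorE gS)//; apply/gen_inv_I01/generatorD_ge1.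
Qed.

End generator.

Lemma tsubnorm_leP (R : realType) (S1 S2 : R -> R -> R) (s1 s2 : R -> \bar R)
    (h := s1 \o gen_inv s2) :
  additive_generator S1 s1 -> additive_generator S2 s2 ->
  (forall x y : R, I01 x -> I01 y -> S1 x y <= S2 x y)
  <->
  (forall u v : R, (s2 1%R <= u%:E)%E -> (s2 1%R <= v%:E)%E ->
     (h (u + v)%:E <= h u%:E + h v%:E)%E).
Proof.
move=> g1 g2; rewrite /h; split=> [S12 u v su sv|hsub x y Ix Iy].
  have Iu := gen_inv_I01 g2 su; have Iv := gen_inv_I01 g2 sv.
  rewrite /= -(generator_op g1 Iu Iv).
  have <- : S2 (gen_inv s2 u%:E) (gen_inv s2 v%:E) = gen_inv s2 (u + v)%:E.
    by rewrite (generatorE g2)// !(gen_invK g2).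
  rewrite (generator_le g1) ?S12//.
    exact: (generator_op_I01 g1).
  exact: (generator_op_I01 g2).
rewrite -(generator_le g1); [|exact: (generator_op_I01 g1)|
  exact: (generator_op_I01 g2)].
rewrite (generator_op g1)//.
have ny z : I01 z -> s1 z != -oo%E.
  by move=> Iz; rewrite -ltNye (lt_le_trans _ (generator_ge0 g1 Iz)).
have pos (z : R) : I01 z -> z = 0 \/ 0 < z.
  rewrite /I01/= in_itv/= le_eqVlt => /andP[/predU1P[<-|z0] _]; first by left.
  by right.
(* Since [hsub] speaks of real arguments only, zero arguments, where the generators are infinite,
   are treated apart: there [s1 x + s1 y] is [+oo]. *)
case: (pos x Ix) => [->|x0]; first by rewrite (generator0 g1) addye ?ny// leey.
case: (pos y Iy) => [->|y0]; first by rewrite (generator0 g1) addey ?ny// leey.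
have := hsub (fine (s2 x)) (fine (s2 y)).
rewrite /= EFinD !fineK ?(generator_fin_num g2)//.
by rewrite !(generatorK g2)// -(generatorE g2)//; apply; exact: (generator_ge1 g2).
Qed.

Theorem theorem3p3 (R : realType) (S1 S2 : R -> R -> R) (s1 s2 : R -> \bar R) :
  tsubnorm S1 -> continuous_on_square S1 -> cancellative S1 ->
  tsubnorm S2 -> continuous_on_square S2 -> cancellative S2 ->
  additive_generator S1 s1 -> (proper_tsubnorm S1 -> s1 1 = 1%E) ->
  additive_generator S2 s2 -> (proper_tsubnorm S2 -> s2 1 = 1%E) ->
  convex_from (s2 1) (s1 \o gen_inv s2) ->
  (forall x y : R, I01 x -> I01 y -> S1 x y <= S2 x y)
  <->
  (forall x y : R, (s2 1%R < x%:E)%E -> x <= y ->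
     ((s1 \o gen_inv s2) y%:E / y%:E <= (s1 \o gen_inv s2) x%:E / x%:E)%E).
Proof.
move=> _ _ _ _ _ _ g1 _ g2 _ hconv.
apply: (iff_trans (tsubnorm_leP g1 g2)).
have I1 : I01 (1 : R) by rewrite /I01/= in_itv/= lexx ler01.
(* Passage to real numbers: [s2] is infinite only at [0], so a real [v >= b] has a positive
   preimage, where [s1] is finite. *)
pose b := fine (s2 1); pose h (v : R) := fine (s1 (gen_inv s2 v%:E)).
have s21 : s2 1 = b%:E by rewrite fineK// (generator_fin_num g2).
have b0 : 0 <= b by rewrite fine_ge0// (generator_ge0 g2).
have hE v : b <= v -> s1 (gen_inv s2 v%:E) = (h v)%:E.
  move=> bv; rewrite fineK// (generator_fin_num g1)//.
    by apply: (gen_inv_I01 g2); rewrite s21 lee_fin.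
  by apply: (gen_inv_gt0 g2); rewrite s21 lee_fin.
rewrite s21 in hconv *.
have hconvR (x y t : R) : b <= x -> b <= y -> 0 <= t <= 1 ->
    h (t * x + (1 - t) * y) <= t * h x + (1 - t) * h y.
  move=> bx by' t01; have /andP[t0 t1] := t01.
  have := hconv x y t; rewrite !lee_fin /= => /(_ bx by').
  rewrite /I01/= in_itv/= t01 !hE//; first by rewrite -!EFinM -EFinD lee_fin; apply.
  by rewrite -[b](subrK (t * b)) addrC lerD//; nra.
have [sub_ratio ratio_sub] := convex_subadditiveP b h b0 hconvR.
have ratioE x y : b < x -> x <= y ->
    (s1 (gen_inv s2 y%:E) / y%:E <= s1 (gen_inv s2 x%:E) / x%:E)%E
    = (h y / y <= h x / x).
  move=> bx xy; have bxy := lt_le_trans bx xy.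
  (* Extended inversion treats [0] separately; [x] and [y] exceed [b >= 0], so the real quotients
     result. *)
  rewrite (hE _ (ltW bx)) (hE _ (ltW bxy)) !inver.
  by rewrite !gt_eqF ?(le_lt_trans b0)// -!EFinM lee_fin.
split=> [hsub x y|hratio u v].
  rewrite lte_fin => bx xy; rewrite /= ratioE//.
  apply: sub_ratio => // u v bu bv.
  have := hsub u v; rewrite !lee_fin /= !hE//; last by lra.
  by rewrite -EFinD lee_fin; apply.
rewrite !lee_fin => bu bv; rewrite /= !hE//; last by lra.
rewrite -EFinD lee_fin; apply: ratio_sub => // x y bx xy.
by rewrite -ratioE//; apply: hratio.
Qed.
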